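(* Assume that $\mathcal{L}_{\min,\mathcal{M}}$ is finite, that $\mathcal{L}$ is restricted $L$-smooth, that the retraction error is controlled with constant $C_{\mathrm R}$ and perturbations $\beta_t\ge0$, and that the estimators $P_t^n$, which at each step $t\ge0$ are built from points $x_1,\dots,x_n$ drawn i.i.d. from $\mu_t$ given $\mathcal{F}_t$, have bounded bias and variance with $c_{\mathrm{bias},2}=0$. Let $(\xi_t)\in\ell^1$ and assume that the step sizes satisfy $$s_t^2\tfrac{L+C_{\mathrm R}}2c_{\mathrm{var},2}\|(I-P_t)g_t\|^2+\beta_t\le\xi_t\qquad\text{and}\qquad s_t\le\bar s:=\tfrac1{L+C_{\mathrm R}}\tfrac{c_{\mathrm{bias},1}}{c_{\mathrm{var},1}}.$$ Then, almost surely, there is a finite (random) constant $C$ such that for all $\tau\in\mathbb{N}$ $$\min_{t=1,\dots,\tau}\|P_tg_t\|\le C\Big(\sum_{t=1}^\tau\sigma_t\Big)^{-1/2}\qquad\text{with}\qquad\sigma_t:=c_{\mathrm{bias},1}s_t-s_t^2\tfrac{L+C_{\mathrm R}}2c_{\mathrm{var},1}.$$ Moreover, almost surely: if $(s_t)\notin\ell^1$, then zero is an accumulation point of the sequence $(\|P_tg_t\|)_t$; and if $s_t\ge s^*$ for all $t$ and some $s^*>0$, then the sequence $(\|P_tg_t\|)_t$ converges to zero.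
   Context: Setting. $\mathcal{X}$ is a set with probability measure $\rho$, $\mathcal{H}$ is a Hilbert space of functions on $\mathcal{X}$ with inner product $(\cdot,\cdot)$ and norm $\|\cdot\|$, $\mathcal{L}:\mathcal{H}\to\mathbb{R}$, $\mathcal{L}(v)=\int \ell(v;x)\,d\rho(x)$ is the expected loss of a loss function $\ell:\mathcal{H}\times\mathcal{X}\to\mathbb{R}$, $\mathcal{M}\subseteq\mathcal{H}$ is a (possibly nonlinear) model class, and $\mathcal{L}_{\min,\mathcal{M}}:=\inf_{u\in\mathcal{M}}\mathcal{L}(u)$. $(\Omega,\Sigma,\mathbb{P},(\mathcal{F}_t)_{t\ge0})$ is a filtered probability space. Algorithm. Given an $\mathcal{F}_0$-measurable $u_0\in\mathcal{M}$, define for $t\ge0$ $$g_t:=\nabla\mathcal{L}(u_t),\qquad \bar u_{t+1}:=u_t-s_tP_t^ng_t,\qquad u_{t+1}:=R_t(\bar u_{t+1}).$$ Here $\mathcal{L}$ is Fréchet differentiable at $u_t$ and $\nabla\mathcal{L}(u_t)\in\mathcal{H}$ is the Riesz representative of the derivative; $\mathcal{T}_t\subseteq\mathcal{H}$ is an $\mathcal{F}_t$-measurable linear space of finite dimension $d_t$ associated with $u_t$; $P_t:\mathcal{H}\to\mathcal{T}_t$ is the $\mathcal{H}$-orthogonal projection; $P_t^n$ is a random operator with values in $\mathcal{T}_t$ (an estimator of $P_t$), built from $n$ sample points drawn at step $t$ conditionally on $\mathcal{F}_t$ from an $\mathcal{F}_t$-dependent probability measure $\mu_t$ on $\mathcal{X}$,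 so that $u_{t+1}$ is $\mathcal{F}_{t+1}$-measurable; the step size $s_t>0$ is $\mathcal{F}_t$-measurable; the retraction $R_t:\mathcal{H}\to\mathcal{M}$ is $\mathcal{F}_t$-measurable. All (conditional) expectations that appear are assumed to exist. Restricted $L$-smoothness: $L>0$ and for all $u_t\in\mathcal{M}$ with associated $\mathcal{T}_t$ and all $g\in\mathcal{T}_t$, $\mathcal{L}(u_t+g)\le\mathcal{L}(u_t)+(\nabla\mathcal{L}(u_t),g)+\frac L2\|g\|^2$. Controlled retraction error with $C_{\mathrm R}>0$ and nonnegative, $\mathcal{F}_t$-measurable $\beta_t$: for all $t$ and $g\in\mathcal{T}_t$, $\mathcal{L}(R_t(u_t+g))\le\mathcal{L}(u_t+g)+\frac{C_{\mathrm R}}2\|g\|^2+\beta_t$. Bounded bias and variance (case $c_{\mathrm{bias},2}=0$): $c_{\mathrm{bias},1},c_{\mathrm{var},1}>0$, $c_{\mathrm{var},2}\ge0$, and for every $t$ and every $\mathcal{F}_t$-measurable $\mathcal{H}$-valued $g$, $\mathbb{E}[(g,P_t^ng)\mid\mathcal{F}_t]\ge c_{\mathrm{bias},1}\|P_tg\|^2$ and $\mathbb{E}[\|P_t^ng\|^2\mid\mathcal{F}_t]\le c_{\mathrm{var},1}\|P_tg\|^2+c_{\mathrm{var},2}\|(I-P_t)g\|^2$. *)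

(* Defs.v *)
From HB Require Import structures.
From mathcomp Require Import all_boot all_order all_algebra.
From mathcomp Require Import sesquilinear.
From mathcomp Require Import all_classical all_reals all_analysis.
From mathcomp Require Import measurable_realfun.

Set Implicit Arguments.
Unset Strict Implicit.
Unset Printing Implicit Defensive.
Import Order.TTheory GRing.Theory Num.Theory.
Import numFieldNormedType.Exports.
Local Open Scope classical_set_scope.
Local Open Scope ring_scope.

Section Hilbert.
Context {R : realType} {H : completeNormedModType R}.

(* Over [R] the involution of the hermitian form is trivial, so
   [{dot H for idfun}] is the type of symmetric positive definite bilinear
   forms; as [H] is complete, [hilbert_dot] says that [H] is a Hilbert space. *)
Definition hilbert_dot (dot : {dot H for idfun}) : Prop :=
  forall v : H, dot v v = `|v| ^+ 2.

Definition is_gradient (dot : {dot H for idfun}) (L : H -> R) (v g : H) : Prop :=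
  differentiable (L : H -> R^o) v /\
  forall h : H, 'd (L : H -> R^o) v h = dot g h.

Definition subspace_of_dim (V : set H) (d : nat) : Prop :=
  exists b : 'I_d -> H,
    (forall c : 'I_d -> R, \sum_(i < d) c i *: b i = 0 -> forall i, c i = 0) /\
    V = [set v | exists c : 'I_d -> R, v = \sum_(i < d) c i *: b i].

Definition orthogonal_projection (dot : {dot H for idfun}) (V : set H)
    (p : H -> H) : Prop :=
  forall h : H, V (p h) /\ forall v, V v -> dot (h - p h) v = 0.

End Hilbert.

Definition borelType {T : topologicalType} := g_sigma_algebraType (@open T).
Arguments borelType T : clear implicits.

Section Conditioning.
Context {R : realType} {d : measure_display} {Omega : measurableType d}
  (P : probability Omega R).

Definition measurable_wrt {d'} {T' : measurableType d'}
    (F : set_system Omega) (f : Omega -> T') : Prop :=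
  measurable_fun setT (f : g_sigma_algebraType F -> T').

Definition filtration (F : nat -> set_system Omega) : Prop :=
  [/\ forall t, sigma_algebra setT (F t),
      forall t, F t `<=` measurable &
      forall t t', (t <= t')%N -> F t `<=` F t'].

Local Open Scope ereal_scope.

Definition is_condexp_ge0 (F : set_system Omega) (X Y : Omega -> \bar R) : Prop :=
  [/\ measurable_wrt F Y, forall w, 0 <= Y w &
      forall A, F A -> \int[P]_(w in A) Y w = \int[P]_(w in A) X w].

(* Generalized conditional expectation E[X | F] = E[X^+ | F] - E[X^- | F]:
   it exists as soon as the two terms are not both infinite, and [X] need not
   be integrable. This matters for bounds on E[(g, Q g) | F] that are required
   for all F-measurable [g], since then (g, Q g) is in general not integrable. *)
Definition is_condexp (F : set_system Omega) (X Y : Omega -> \bar R) : Prop :=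
  [/\ measurable_fun setT X, measurable_wrt F Y &
      exists Yp Ym : Omega -> \bar R,
        [/\ is_condexp_ge0 F X^\+ Yp, is_condexp_ge0 F X^\- Ym &
            {ae P, forall w,
               (Yp w < +oo \/ Ym w < +oo) /\ Y w = Yp w - Ym w}]].

Definition cond_iid {dX} {X : measurableType dX} (F : set_system Omega)
    (mu : Omega -> probability X R) (n : nat) (x : Omega -> n.-tuple X) : Prop :=
  [/\ measurable_fun setT x,
      forall B, measurable B -> measurable_wrt F (fun w => mu w B) &
      forall (A : set Omega) (B : 'I_n -> set X),
        F A -> (forall i, measurable (B i)) ->
        P (A `&` [set w | forall i, B i (tnth (x w) i)]) =
        \int[P]_(w in A) \prod_(i < n) mu w (B i)].

End Conditioning.

Section Descent.
Context {R : realType} {H : completeNormedModType R} {d : measure_display}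
  {Omega : measurableType d} (P : probability Omega R)
  (dot : {dot H for idfun}) (L : H -> R).

Definition measurableH (F : set_system Omega) (f : Omega -> H) : Prop :=
  measurable_wrt F (f : Omega -> borelType H).

(* [est t w x] is the estimator built in state [w] from the sample [x]; apart
   from the sample it depends on [w] only through the information in [F t]. *)
Definition built_from_samples {dX} {X : measurableType dX} (n : nat)
    (F : nat -> set_system Omega)
    (est : nat -> Omega -> n.-tuple X -> H -> H)
    (x : nat -> Omega -> n.-tuple X) (Pn : nat -> Omega -> H -> H) : Prop :=
  forall t,
    (forall h : H,
       measurable_fun setT
         ((fun z => est t z.1 z.2 h) :
            (g_sigma_algebraType (F t) * n.-tuple X)%type -> borelType H)) /\
    (forall w h, Pn t w h = est t w (x t w) h).

Definition restricted_smooth (u g : nat -> Omega -> H)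
    (T : nat -> Omega -> set H) (Lip : R) : Prop :=
  forall t w v, T t w v ->
    L (u t w + v) <= L (u t w) + dot (g t w) v + Lip / 2 * `|v| ^+ 2.

Definition controlled_retraction (u : nat -> Omega -> H)
    (T : nat -> Omega -> set H) (Rt : nat -> Omega -> H -> H)
    (CR : R) (beta : nat -> Omega -> R) : Prop :=
  forall t w v, T t w v ->
    L (Rt t w (u t w + v)) <= L (u t w + v) + CR / 2 * `|v| ^+ 2 + beta t w.

Definition bounded_bias (F : nat -> set_system Omega)
    (Pt Pn : nat -> Omega -> H -> H) (cbias1 : R) : Prop :=
  forall t (g : Omega -> H), measurableH (F t) g ->
    exists Y, is_condexp P (F t) (fun w => (dot (g w) (Pn t w (g w)))%:E) Y /\
      {ae P, forall w, ((cbias1 * `|Pt t w (g w)| ^+ 2)%:E <= Y w)%E}.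

Definition bounded_variance (F : nat -> set_system Omega)
    (Pt Pn : nat -> Omega -> H -> H) (cvar1 cvar2 : R) : Prop :=
  forall t (g : Omega -> H), measurableH (F t) g ->
    exists Y, is_condexp P (F t) (fun w => (`|Pn t w (g w)| ^+ 2)%:E) Y /\
      {ae P, forall w,
        (Y w <= (cvar1 * `|Pt t w (g w)| ^+ 2 +
                 cvar2 * `|g w - Pt t w (g w)| ^+ 2)%:E)%E}.

End Descent.

Definition ell1 {R : realType} (a : nat -> R) : Prop := cvgn [normed series a].

(* Main.v *)
Require Import Defs.
From HB Require Import structures.
From mathcomp Require Import all_boot all_order all_algebra.
From mathcomp Require Import all_classical all_reals all_analysis.
From mathcomp Require Import measurable_realfun sesquilinear.
From mathcomp Require Import ring lra.

Set Implicit Arguments.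
Unset Strict Implicit.
Unset Printing Implicit Defensive.
Import Order.TTheory GRing.Theory Num.Theory.
Import numFieldNormedType.Exports.
Local Open Scope classical_set_scope.
Local Open Scope ring_scope.

(** Write [V_t := L (u_t) - inf_M L >= 0] and [kappa := (Lip + CR) / 2].
Restricted smoothness and the retraction bound give, pointwise,
[[
  V_{t+1} <= V_t - s_t (g_t, P_t^n g_t) + kappa s_t^2 |P_t^n g_t|^2 + beta_t.
]]
Taking conditional expectations given [F_t], the bias bound turns the second
term into at least [cbias1 s_t |P_t g_t|^2], the variance bound turns the third
one into at most [kappa s_t^2 (cvar1 |P_t g_t|^2 + cvar2 |g_t - P_t g_t|^2)],
and the step size condition absorbs the last part and [beta_t] into [xi_t]:
[[
  E[V_{t+1} | F_t] <= V_t - sigma_t |P_t g_t|^2 + xi_t.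
]]
So [V] is a nonnegative almost supermartingale in the sense of Robbins and
Siegmund, and [sum_t sigma_t |P_t g_t|^2] is almost surely finite. As
[s_t <= sbar] forces [sigma_t >= cbias1 s_t / 2], the three conclusions are
elementary facts on one trajectory ([min_le_rate], [not_summable_cluster0],
[steps_bounded_below_cvg0]).

Three points need care.

- The bias and variance bounds can be applied to [g_t] only once [g_t] is known
  to be Borel measurable. No regularity of [L] is assumed away from the
  iterates, so a difference quotient of [L] at [u_t] need not be measurable, and
  as [H] may be nonseparable, testing against a countable family of vectors is
  not enough. The lemma [measurable_gradient] rests on the fact that
  on the set where an arbitrary function is differentiable, the preimage of an
  open set under its gradient is a countable union of relatively closed sets.

- Neither [V_t] nor [(g_t, P_t^n g_t)] need be integrable. The descent
  inequality is therefore carried in the form of integrals over the events of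
  [F_t], with all terms nonnegative and each one on the side where it has a
  positive sign ([one_step_descent]); infinite terms are cancelled after
  localization ([integral_le_cancel]). The weights [s_t] enter through
  [integral_condexp_weight].

- The finiteness of the sum follows from a stopping argument: on the event that
  [V_0] and the partial sums of [xi] stay below a level [K], the mean of the sum
  is at most [2 K] ([almost_supermartingale_sum]). *)

(** * Measurability with respect to a sub-sigma-algebra *)

Lemma measurable_wrtP {d} {Omega : measurableType d} {d'}
    {T' : measurableType d'} (F : set_system Omega) (f : Omega -> T') :
  sigma_algebra setT F ->
  measurable_wrt F f <-> forall B, measurable B -> F (f @^-1` B).
Proof.
move=> sF; split=> mf.
  move=> B mB; have := mf measurableT B mB; rewrite setTI.
  by rewrite measurable_g_measurableTypeE.
by move=> _ B mB; rewrite setTI measurable_g_measurableTypeE//; exact: mf.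
Qed.

Lemma measurableHP {R : realType} {H : completeNormedModType R} {d}
    {Omega : measurableType d} (F : set_system Omega) (f : Omega -> H) :
  sigma_algebra setT F ->
  measurableH F f <-> forall O, open O -> F (f @^-1` O).
Proof.
move=> sF; rewrite /measurableH; split=> [/measurable_wrtP mf O oO|mf].
  by apply: mf => //; exact: sub_sigma_algebra.
apply: (@measurability _ _ (g_sigma_algebraType F) (borelType H) setT f open)
  => //.
by move=> _ [B oB <-]; rewrite setTI measurable_g_measurableTypeE//; exact: mf.
Qed.

(** * Measurability of the gradient along the iterates *)

Section Gradient.
Context {R : realType} {H : completeNormedModType R} (dot : {dot H for idfun})
  (L : H -> R).

Lemma gradient_expansion v g e : is_gradient dot L v g -> 0 < e ->
  exists2 r : R, 0 < r &
    forall h : H, `|h| < r -> `|L (v + h) - L v - dot g h| <= e * `|h|.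
Proof.
move=> [dL gE] e0.
have := diff_locallyxC dL.
set rem := (X in forall h, _ = _ + X h) => expand.
have : \forall h \near (0 : H), `|rem h| <= e * `|h|.
  exact: (littleoP rem).
move=> /nbhs_ballP[r /= r0 hr]; exists r => // h hlt.
rewrite expand gE [_ + _ - L v]addrC !addrA addNr add0r [_ + rem h]addrC addrK.
by apply: hr; rewrite -ball_normE /= sub0r normrN.
Qed.

Hypothesis hdot : hilbert_dot dot.

Lemma norm_le_of_dot_ball (a : H) (r c : R) : 0 < r ->
  (forall h : H, `|h| < r -> `|dot a h| <= c) -> `|a| * r <= 2 * c.
Proof.
move=> r0 ac; have [->|a0] := eqVneq a 0.
  have := ac 0; rewrite !normr0 => /(_ r0) /(le_trans (normr_ge0 _)); lra.
have na0 : 0 < `|a| by rewrite normr_gt0.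
have := ac ((r / 2 / `|a|) *: a).
have -> : dot a ((r / 2 / `|a|) *: a) = `|a| * (r / 2).
  by rewrite linearZr_LR /= hdot; field; rewrite normr_eq0.
rewrite normrZ normrM ger0_norm; last by rewrite !divr_ge0// ltW.
rewrite normfV normr_id divfK ?normr_eq0//.
rewrite gtr0_norm ?mulr_gt0 ?divr_gt0//.
by move=> /(_ ltac:(lra)); lra.
Qed.

(** The slope is tested on all pairs of points of the ball, and not only on pairs
containing its centre [v], so that it also describes [L] around points near [v];
the radius [9 / (k + 1)] leaves room for the error made in passing to them, which
is at most [8 / (k + 1)]. *)
Definition uniform_slope (O : set H) (k N : nat) : set H :=
  [set v | exists2 g : H, ball g (9 / k.+1%:R) `<=` O &
    forall r, 0 < r -> r <= N.+1%:R^-1 ->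
    forall y z, ball v r y -> ball v r z ->
      `|L y - L z - dot g (y - z)| <= r / k.+1%:R].

(** Comparing both points with the centre, the differentiability of [L] at [v]
with error [1 / (2 (k + 1))] gives the slope [g] on pairs of points. *)
Lemma gradient_uniform_slope (O : set H) v g :
  open O -> is_gradient dot L v g -> O g -> exists k N, uniform_slope O k N v.
Proof.
move=> oO hg Og.
have /nbhs_ballP[e /= e0 eO] := open_nbhs_nbhs (conj oO Og).
pose k := Num.truncn (9 / e).
have k8 : 9 / k.+1%:R <= e.
  by rewrite ler_pdivrMr ?ltr0n// mulrC -ler_pdivrMr// ltW// truncnS_gt.
have [r0 r00 hr0] := gradient_expansion hg (e := (2 * k.+1%:R)^-1)
  ltac:(by rewrite invr_gt0 mulr_gt0 ?ltr0n).
exists k, (Num.truncn r0^-1); exists g.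
  by apply: subset_trans eO; exact: le_ball.
move=> r rp rN y z vy vz.
have rr0 : r <= r0.
  apply: (le_trans rN); rewrite invf_ple ?posrE ?ltr0n//.
  by rewrite ltW// truncnS_gt.
have key y' : ball v r y' ->
    `|L y' - L v - dot g (y' - v)| <= r / k.+1%:R / 2.
  rewrite -ball_normE /= distrC => vy'.
  have := hr0 (y' - v) (lt_le_trans vy' rr0); rewrite [v + _]addrC subrK.
  move=> /le_trans; apply.
  rewrite (_ : r / k.+1%:R / 2 = (2 * k.+1%:R)^-1 * r).
    by rewrite ler_wpM2l ?invr_ge0 ?mulr_ge0// ltW.
  by rewrite invfM; ring.
have -> : L y - L z - dot g (y - z) =
    (L y - L v - dot g (y - v)) - (L z - L v - dot g (z - v)).
  rewrite !linearBr; ring.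
apply: (le_trans (ler_normB _ _)).
by rewrite (splitr (r / _)) lerD// key.
Qed.

(** Fix a scale [r] at which the expansion of [L] at [v] is already accurate, and
a point [v'] of the set within [r / 2] of [v]. Its slope [g'] and the gradient
[g] then describe the same increments of [L] on the ball of radius [r / 2]
around [v], so [g] is close to [g'] and lies in the ball around [g'] contained
in [O]. The scale depends on [v], but [v'] is available at every scale. *)
Lemma closure_uniform_slope (O : set H) v g k N : is_gradient dot L v g ->
  closure (uniform_slope O k N) v -> O g.
Proof.
move=> hg clv.
have k0 : 0 < k.+1%:R :> R by rewrite ltr0n.
have [r0 r00 hr0] := gradient_expansion hg (e := k.+1%:R^-1)
  ltac:(by rewrite invr_gt0).
pose r := Num.min r0 N.+1%:R^-1.
have rp : 0 < r by rewrite lt_min r00 invr_gt0 ltr0n.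
have r20 : 0 < r / 2 by rewrite divr_gt0.
have [v' [[g' g'O slope] vv']] := clv (ball v (r / 2))
  (nbhsx_ballx _ _ r20).
have v'v : ball v' (r / 2) v by exact: ball_sym.
apply: g'O; rewrite -ball_normE /=.
have ball_le : forall h : H, `|h| < r / 2 ->
    `|dot (g' - g) h| <= 2 * (r / k.+1%:R).
  move=> h hh.
  have v'h : ball v' r (v + h).
    rewrite -ball_normE /= opprD addrA; apply: le_lt_trans (ler_normB _ _) _.
    by move: v'v; rewrite -ball_normE /=; lra.
  have v'r : ball v' r v by apply: le_ball v'v; lra.
  have h1 := slope r rp (ltac:(by rewrite ge_min lexx orbT)) _ _ v'h v'r.
  have hr : `|h| < r0.
    have : r <= r0 by rewrite ge_min lexx.
    lra.
  move: h1 (hr0 h hr); rewrite [v + h]addrC addrK => h1 h2.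
  rewrite linearBl (_ : dot g' h - dot g h =
    (L (h + v) - L v - dot g h) - (L (h + v) - L v - dot g' h)); last by ring.
  apply: (le_trans (ler_normB _ _)).
  rewrite -[2]/(1 + 1) mulrDl !mul1r lerD// (le_trans h2)//.
  by rewrite mulrC ler_wpM2r ?invr_ge0 ?(ltW k0)//; lra.
have := norm_le_of_dot_ball r20 ball_le.
rewrite (_ : 2 * (2 * _) = 8 / k.+1%:R * (r / 2)); last by field; lra.
rewrite ler_pM2r// => le8; apply: le_lt_trans le8 _.
by rewrite ltr_pM2r ?invr_gt0// ltr_nat.
Qed.
End Gradient.

Section MeasurableGradient.
Context {R : realType} {H : completeNormedModType R} (dot : {dot H for idfun})
  (L : H -> R) {d : measure_display} {Omega : measurableType d}
  (F : set_system Omega) (u g : Omega -> H).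
Hypotheses (sF : sigma_algebra setT F) (hu : measurableH F u)
  (hg : forall w, is_gradient dot L (u w) (g w)).

(** The preimage of [O] is the countable union over [k] and [N] of the preimages
of the closed sets [closure (uniform_slope O k N)]: the two lemmas above give
the two inclusions, because all iterates are points of differentiability. *)
Lemma measurable_gradient : hilbert_dot dot -> measurableH F g.
Proof.
move=> hdot; apply/measurableHP => // O oO.
have -> : g @^-1` O = \bigcup_k \bigcup_N
    (u @^-1` closure (uniform_slope dot L O k N)).
  apply/seteqP; split=> w /=.
    move=> /(gradient_uniform_slope oO (hg w))[k [N Ekn]].
    by exists k => //; exists N => //; exact: subset_closure.
  by move=> [k _ [N _]]; exact: closure_uniform_slope.
have [_ FC FU] := sF.
apply: (FU _) => k; apply: (FU _) => N.
have := FC _ (proj1 (measurableHP _ sF) hu _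
  (closed_openC (@closed_closure _ (uniform_slope dot L O k N)))).
by rewrite setTD -preimage_setC setCK.
Qed.

(** [L] itself need not be measurable, but it is continuous at every iterate, so
that an iterate with [L > a] lies in the interior of [L > a]. *)
Lemma measurable_loss : measurable_wrt F (L \o u).
Proof.
apply: (@measurability _ _ (g_sigma_algebraType F) R setT (L \o u)
  (@RGenOInfty.G R)); first exact: RGenOInfty.measurableE.
move=> _ [B [a ->] <-].
rewrite setTI measurable_g_measurableTypeE//.
have -> : (L \o u) @^-1` `]a, +oo[ = u @^-1` (L @^-1` `]a, +oo[)^°.
  apply/seteqP; split=> w /=; last exact: interior_subset.
  move=> Lw; have [dL _] := hg w.
  by apply: (differentiable_continuous dL); exact: open_nbhs_nbhs.
by apply: (proj1 (measurableHP _ sF) hu); exact: open_interior.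
Qed.

End MeasurableGradient.

(** * Weights in conditional expectations *)

Section WeightedConditionalExpectation.
Context {R : realType} {d : measure_display} {Omega : measurableType d}
  (P : probability Omega R) (F : set_system Omega).
Hypotheses (sF : sigma_algebra setT F) (FM : F `<=` measurable).

Lemma measurable_wrtW {d'} {T' : measurableType d'} (f : Omega -> T') :
  measurable_wrt F f -> measurable_fun setT f.
Proof.
move=> /(measurable_wrtP _ sF) mf _ B mB; rewrite setTI.
by apply: FM; exact: mf.
Qed.

Lemma sub_sigma_setI (A B : set Omega) : F A -> F B -> F (A `&` B).
Proof.
rewrite -(measurable_g_measurableTypeE sF).
exact: (@measurableI _ (g_sigma_algebraType F)).
Qed.

Lemma sub_sigma_setT : F setT.
Proof. by rewrite -(measurable_g_measurableTypeE sF); exact: measurableT. Qed.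

Import HBNNSimple.
Local Open Scope ereal_scope.

Lemma integral_nnsfunM (h : {nnsfun g_sigma_algebraType F >-> R})
    (A : set Omega) (Z : Omega -> \bar R) :
  F A -> measurable_fun setT Z -> (forall w, 0 <= Z w) ->
  \int[P]_(w in A) ((h w)%:E * Z w) =
  \sum_(y \in range h)
    (y%:E * \int[P]_(w in A `&` (h @^-1` [set y] : set Omega)) Z w).
Proof.
move=> FA mZ Z0.
have mh y : F (h @^-1` [set y]).
  by apply: (proj1 (measurable_wrtP _ sF) (@measurable_funPT _ _ _ _ h)).
have mi y : measurable_fun A (fun w : Omega => (\1_(h @^-1` [set y]) w : R)%:E).
  apply/measurable_EFinP; apply: measurable_funTS; apply: measurable_indic.
  exact: FM.
transitivity (\int[P]_(w in A)
    (\sum_(y \in range h) (y%:E * ((\1_(h @^-1` [set y]) w)%:E * Z w)))).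
  apply: eq_integral => w _; rewrite {1}(fimfunE h) -fsumEFin//.
  rewrite ge0_mule_fsuml => [|y]; last exact: nnfun_muleindic_ge0.
  by apply: eq_fsbigr => y _; rewrite EFinM muleA.
rewrite ge0_integral_fsum//; last 3 first.
- exact: FM.
- move=> y; apply: emeasurable_funM; first exact: measurable_cst.
  by apply: emeasurable_funM => //; exact: measurable_funTS.
- by move=> y w _; rewrite muleA mule_ge0// nnfun_muleindic_ge0.
apply: eq_fsbigr => y; rewrite inE => -[w0 _ <-].
rewrite ge0_integralZl//; last 4 first.
- exact: FM.
- by apply: emeasurable_funM => //; exact: measurable_funTS.
- by move=> w _; rewrite mule_ge0// lee_fin.
- by rewrite lee_fin.
congr (_ * _); rewrite integral_mkcondr; apply: eq_integral => w _.
by rewrite epatch_indic /= muleC.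
Qed.

(** The defining identity of the conditional expectation is the case of an
indicator; simple functions follow by linearity and nonnegative weights by
monotone convergence. *)
Lemma integral_condexp_weight (X Y : Omega -> \bar R) (f : Omega -> R)
    (A : set Omega) :
  measurable_fun setT X -> (forall w, 0 <= X w) -> is_condexp_ge0 P F X Y ->
  measurable_wrt F f -> (forall w, (0 <= f w)%R) -> F A ->
  \int[P]_(w in A) ((f w)%:E * Y w) = \int[P]_(w in A) ((f w)%:E * X w).
Proof.
move=> mX X0 [mY Y0 YX] mf f0 FA.
have mf' : measurable_fun setT (EFin \o f : g_sigma_algebraType F -> \bar R).
  exact/measurable_EFinP.
pose h := nnsfun_approx measurableT mf'.
have nd_h w : {homo (fun n => h n w) : a b / (a <= b)%N >-> (a <= b)%R}.
  by move=> a b ab; exact/lefP/nd_nnsfun_approx.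
have ch w : (h n w)%:E @[n --> \oo] --> (f w)%:E.
  by apply: (cvg_nnsfun_approx measurableT mf') => // ? _; rewrite lee_fin.
have approx (Z : Omega -> \bar R) : measurable_fun setT Z ->
    (forall w, 0 <= Z w) -> \int[P]_(w in A) ((f w)%:E * Z w) =
    limn (fun n => \int[P]_(w in A) ((h n w)%:E * Z w)).
  move=> mZ Z0; rewrite -monotone_convergence//; last 4 first.
  - exact: FM.
  - move=> n; apply: emeasurable_funM; last exact: measurable_funTS.
    apply/measurable_EFinP; apply: measurable_funTS.
    exact: (@measurable_wrtW _ _ (h n) (@measurable_funPT _ _ _ _ (h n))).
  - by move=> n w _; rewrite mule_ge0// lee_fin.
  - by move=> w _ a b ab; rewrite lee_wpmul2r// lee_fin nd_h.
  apply: eq_integral => w _; apply/esym/cvg_lim => //.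
  (* If [Z w] is infinite, multiplication by it is not continuous at [0]; there
     the approximations of [f w] vanish identically. *)
  have [Zfin|] := boolP (Z w \is a fin_num); first exact: cvgeZr.
  rewrite ge0_fin_numE// -leNgt leye_eq => /eqP ->.
  have [fw0|fw0] := eqVneq (f w) 0%R; last first.
    apply: cvgeM; [|exact: ch|exact: cvg_cst].
    by rewrite neq0_mule_def // mule_neq0.

  rewrite fw0 mul0e; apply: cvg_near_cst; apply: nearW => n.
  suff -> : h n w = 0%R by rewrite mul0e.
  apply/eqP; rewrite eq_le fun_ge0 andbT -lee_fin -fw0.
  have sup_h : (h m w)%:E @[m --> \oo] -->
      ereal_sup (range (fun m => (h m w)%:E)).
    by apply: (@ereal_nondecreasing_cvgn R) => a b ab; rewrite lee_fin nd_h.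
  rewrite (cvg_unique _ (ch w) sup_h)//.
  by apply: ereal_sup_ubound; exists n.
rewrite approx; [|exact: measurable_wrtW|by []].
rewrite approx//; congr (lim (_ @ \oo)); apply/funext => n.
rewrite !integral_nnsfunM//; last exact: measurable_wrtW.
apply: eq_fsbigr => y _; rewrite YX//.
apply: sub_sigma_setI => //.
by apply: (proj1 (measurable_wrtP _ sF) (@measurable_funPT _ _ _ _ (h n))).
Qed.

End WeightedConditionalExpectation.

(** * Nonnegative almost supermartingales *)

Section AlmostSupermartingale.
Context {R : realType} {d : measure_display} {Omega : measurableType d}
  (P : probability Omega R) (F : nat -> set_system Omega).
Hypothesis hF : filtration F.

Lemma measurable_wrt_filtration {d'} {T' : measurableType d'} s t
    (f : Omega -> T') :
  (s <= t)%N -> measurable_wrt (F s) f -> measurable_wrt (F t) f.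
Proof.
have [sF _ Fle] := hF => st /(measurable_wrtP _ (sF s)) mf.
by apply/(measurable_wrtP _ (sF t)) => B mB; apply: (Fle _ _ st); exact: mf.
Qed.

Variables (V xi : nat -> Omega -> R) (W : nat -> Omega -> \bar R).
Hypotheses (V_ge0 : forall t w, 0 <= V t w) (xi_ge0 : forall t w, 0 <= xi t w)
  (W_ge0 : forall t w, (0 <= W t w)%E).
Hypotheses (mV0 : measurable_wrt (F 0%N) (V 0%N))
  (mV : forall t, measurable_fun setT (V t))
  (mxi : forall t, measurable_wrt (F t) (xi t))
  (mW : forall t, measurable_fun setT (W t)).
Local Open Scope ereal_scope.
Hypothesis descent : forall t A, F t A ->
  \int[P]_(w in A) (V t.+1 w)%:E + \int[P]_(w in A) W t w <=
  \int[P]_(w in A) (V t w)%:E + \int[P]_(w in A) (xi t w)%:E.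

Let S t w : R := (\sum_(i < t) xi i w)%R.

(** The partial sum includes [xi t], which is known at time [t]: the event belongs
to [F t] and yet bounds the sum after the step from [t] to [t + 1]. *)
Let bounded_until (K : R) t : set Omega :=
  [set w | (V 0%N w <= K)%R /\ (S t.+1 w <= K)%R].

Let S_ge0 t w : (0 <= S t w)%R. Proof. exact: sumr_ge0. Qed.

Let SS t w : S t.+1 w = (S t w + xi t w)%R.
Proof. by rewrite /S big_ord_recr. Qed.

Let mS s t : (s <= t.+1)%N -> measurable_wrt (F t) (S s).
Proof.
move=> st; apply: (@measurable_sum _ (g_sigma_algebraType (F t))) => i.
apply: (measurable_wrt_filtration _ (@mxi i)).
by rewrite -ltnS (leq_trans (ltn_ord i)).
Qed.

Let mST t : measurable_fun setT (S t).
Proof.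
have [sF FM _] := hF.
by apply: (measurable_wrtW (sF t) (FM t)); exact: mS.
Qed.

Let bounded_untilF K t : F t (bounded_until K t).
Proof.
have [sF _ _] := hF.
have half (f : Omega -> R) :
    measurable_wrt (F t) f -> F t [set w | (f w <= K)%R].
  move=> /(measurable_wrtP _ (sF t)) /(_ `]-oo, K]%classic (measurable_itv _)).
  by congr F; apply/seteqP; split=> w /=; rewrite in_itv.
apply: (sub_sigma_setI (sF t)); last by apply: half; exact: mS.
by apply: half; exact: measurable_wrt_filtration mV0.
Qed.

Let bounded_untilM K t : measurable (bounded_until K t).
Proof. by have [_ FM _] := hF; exact/FM/bounded_untilF. Qed.

Let bounded_untilS K t : bounded_until K t.+1 `<=` bounded_until K t.
Proof.
move=> w [V0 SK]; split=> //; apply: le_trans SK.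
by rewrite (SS t.+1) lerDl.
Qed.

(** On [bounded_until K t] the unspent budget [K - S t] is nonnegative, and
[V + (K - S)] is a supermartingale with drift [W]: adding [xi t] to [V] is
compensated by the decrease of the budget. The events shrink with [t], which
only decreases the integral of the nonnegative [V + (K - S)]. *)
Let stopped_energy K t :
  \int[P]_(w in bounded_until K t) (V t w + (K - S t w))%:E +
    \sum_(i < t) \int[P]_(w in bounded_until K i) W i w <=
  \int[P]_(w in bounded_until K 0) (V 0%N w + (K - S 0 w))%:E.
Proof.
elim: t => [|t IH]; first by rewrite big_ord0 adde0.
apply: le_trans IH; rewrite big_ord_recr /= addeA addeAC leeD2r//.
have S1K w : bounded_until K t w -> (0 <= K - S t.+1 w)%R.
  by move=> [_]; rewrite subr_ge0.
have SK w : bounded_until K t w -> (0 <= K - S t w)%R.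
  by move=> /S1K; rewrite SS; have := xi_ge0 t w; lra.
have mD (f : Omega -> R) D : measurable_fun setT f ->
    measurable_fun D (fun w => (f w)%:E).
  by move=> mf; apply/measurable_EFinP; exact: measurable_funTS.
have mKS s : measurable_fun setT (fun w => (K - S s w)%R).
  exact: measurable_funB.
apply: (@le_trans _ _ (\int[P]_(w in bounded_until K t)
    (V t.+1 w + (K - S t.+1 w))%:E + \int[P]_(w in bounded_until K t) W t w)).
  apply: leeD2r; apply: ge0_subset_integral => //.
    by apply: mD; exact: measurable_funD.
  by move=> w bw; rewrite lee_fin addr_ge0// S1K.
under eq_integral do rewrite EFinD.
rewrite ge0_integralD//; [|by move=> w _; rewrite lee_fin|exact: mD|exact: mD].
rewrite addeAC.
apply: (le_trans (leeD2r _ (descent (bounded_untilF K t)))).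
under [leRHS]eq_integral do rewrite EFinD.
rewrite [leRHS]ge0_integralD//; [|by move=> w _; rewrite lee_fin|exact: mD|
  exact: mD].
rewrite -addeA leeD2l//.
have [sF FM _] := hF.
rewrite -ge0_integralD//; [|by move=> w _; rewrite lee_fin| |exact: mD];
  last first.
  by apply: mD; exact: (measurable_wrtW (sF t) (FM t)).
rewrite (eq_integral (fun w => (K - S t w)%:E))// => w _.
by rewrite -EFinD SS; congr EFin; ring.
Qed.

(** Every trajectory with summable [xi] stays for some integer [K] in all the
events [bounded_until K t], and on their intersection [stopped_energy] bounds
the integral of the sum of [W] by [2 K]. *)
Lemma almost_supermartingale_sum :
  {ae P, forall w, cvgn (series (xi ^~ w)) -> \sum_(0 <= t <oo) W t w < +oo}.
Proof.
pose B (K : nat) := \bigcap_t bounded_until K%:R t.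
have mB K : measurable (B K) by exact: bigcapT_measurable.
have msum : measurable_fun setT (fun w => \sum_(0 <= t <oo) W t w).
  by apply: ge0_emeasurable_sum.
suff fin K : {ae P, forall w, B K w -> \sum_(0 <= t <oo) W t w \is a fin_num}.
  have := ae_foralln fin; apply: filterS => w allK cxi.
  have S_le t : (S t w <= limn (series (xi ^~ w)))%R.
    have -> : S t w = series (xi ^~ w) t by rewrite /S /series /= big_mkord.
    apply: nondecreasing_cvgn_le => //; apply/nondecreasing_seqP => m.
    by rewrite !seriesEnat /= big_nat_recr//= lerDl.
  pose m := Num.max (V 0%N w) (limn (series (xi ^~ w))).
  have mle : (m <= (Num.truncn m).+1%:R)%R by rewrite ltW// truncnS_gt.
  have /allK : B (Num.truncn m).+1 w.
    move=> t _; split; apply: le_trans mle; rewrite le_max ?lexx// S_le ?orbT//.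
  by rewrite ge0_fin_numE// nneseries_ge0.
suff : P.-integrable (B K) (fun w => \sum_(0 <= t <oo) W t w).
  exact: integrable_ae.
apply/integrableP; split; first exact: measurable_funTS.
under eq_integral do rewrite gee0_abs ?nneseries_ge0//.
rewrite integral_nneseries//; last by move=> t; exact: measurable_funTS.
apply: (@le_lt_trans _ _ (K%:R + K%:R)%:E); last by rewrite ltry.
apply: lime_le; first by apply: is_cvg_nneseries => t _ _; exact: integral_ge0.
apply: nearW => t; rewrite big_mkord.
apply: (@le_trans _ _ (\sum_(i < t) \int[P]_(w in bounded_until K%:R i) W i w)).
  apply: lee_sum => i _; apply: ge0_subset_integral => //.
    exact: measurable_funTS.
  by move=> w /(_ i I).
apply: le_trans (le_trans (stopped_energy K%:R t) _).
  rewrite leeDr//; apply: integral_ge0 => w [_ SK].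
  rewrite lee_fin addr_ge0// subr_ge0 (le_trans _ SK)// SS lerDl//.
apply: (@le_trans _ _ (\int[P]_(w in bounded_until K%:R 0) (K%:R + K%:R)%:E)).
  apply: ge0_le_integral => //.
  - by move=> w [_ SK]; rewrite lee_fin addr_ge0// subr_ge0 /S big_ord0.
  - apply/measurable_EFinP; apply: measurable_funTS.
    apply: measurable_funD => //.
    exact: measurable_funB.
  - by move=> w [V0 _]; rewrite lee_fin lerD// /S big_ord0 subr0.
rewrite integral_cst// -[leRHS]mule1 lee_wpmul2l//.
exact: probability_le1.
Qed.

End AlmostSupermartingale.

(** * Consequences of a finite weighted sum of squares *)

Section WeightedSquareSum.
Context {R : realType} (c B : R) (s sigma p : nat -> R).
Hypotheses (c_gt0 : 0 < c) (s_gt0 : forall t, 0 < s t)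
  (sigma_ge : forall t, c * s t <= sigma t) (p_ge0 : forall t, 0 <= p t)
  (sumB : forall a b, \sum_(a <= t < b) sigma t * p t ^+ 2 <= B).

Let sigma_gt0 t : 0 < sigma t.
Proof. by apply: lt_le_trans (sigma_ge t); rewrite mulr_gt0. Qed.

(** The square of the minimum times the sum of the weights is at most the
weighted sum of squares. *)
Lemma min_le_rate tau : (1 <= tau)%N ->
  \big[Num.min/p 1%N]_(1 <= t < tau.+1) p t <=
    Num.sqrt B * (\sum_(1 <= t < tau.+1) sigma t) `^ (- 2^-1).
Proof.
move=> tau1; set m := \big[_/_]_(_ <= _ < _) _; set Sg := \sum_(_ <= _ < _) _.
have m0 : 0 <= m.
  by rewrite /m; elim/big_ind : _ => // x y x0 y0; rewrite le_min x0.
have Sg0 : 0 < Sg.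
  rewrite /Sg big_ltn ?ltnS// ltr_pwDl// sumr_ge0// => t _; exact: ltW.
have mp t : t \in index_iota 1 tau.+1 -> m <= p t.
  by move=> tin; apply: ge_bigmin_seq.
have mS : m ^+ 2 * Sg <= B.
  apply: le_trans (sumB 1 tau.+1); rewrite mulr_sumr.
  rewrite big_seq [leRHS]big_seq; apply: ler_sum => t tin.
  by rewrite mulrC ler_pM2l// lerXn2r ?nnegrE// mp.
rewrite powRN powR12_sqrt ?(ltW Sg0)// ler_pdivlMr ?sqrtr_gt0//.
have -> : m = Num.sqrt (m ^+ 2) by rewrite sqrtr_sqr ger0_norm.
by rewrite -sqrtrM ?sqr_ge0// ler_wsqrtr.
Qed.

(** If [p] stayed above some [e > 0] from some time on, the tail of the sum of [s]
would be at most [B / (c e^2)]. *)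
Lemma not_summable_cluster0 : ~ ell1 s -> cluster (p @ \oo) 0.
Proof.
move=> ns A U [N _ NA] /nbhs_ballP[e /= e0 eU].
apply: contrapT => noAU; apply: ns.
have p_ge t : (N <= t)%N -> e <= p t.
  move=> Nt; rewrite leNgt; apply/negP => pe; apply: noAU; exists (p t); split.
    exact: NA.
  by apply: eU; rewrite -ball_normE /= sub0r normrN ger0_norm.
have e2 : 0 < c * e ^+ 2 by rewrite mulr_gt0// exprn_gt0.
have bound b : \sum_(N <= t < b) s t <= B / (c * e ^+ 2).
  rewrite ler_pdivlMr// mulr_suml; apply: le_trans (sumB N b).
  apply: ler_sum_nat => t /andP[Nt _].
  rewrite mulrA [s t * c]mulrC; apply: ler_pM => //.
  - by rewrite ltW// mulr_gt0.
  - exact: sqr_ge0.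
  - by rewrite lerXn2r ?nnegrE ?(ltW e0)// p_ge.
have se : [normed series s] = series s.
  by congr series; apply/funext => t /=; rewrite gtr0_norm.
rewrite /ell1 se; apply: nondecreasing_is_cvgn.
  apply/nondecreasing_seqP => n.
  by rewrite !seriesEnat /= big_nat_recr//= lerDl ltW.
exists (\sum_(0 <= t < N) s t + B / (c * e ^+ 2)) => _ [n _ <-].
have [nN|Nn] := leqP n N.
  rewrite seriesEnat /= (big_cat_nat (leq0n n) nN)//= -addrA lerDl addr_ge0//.
    by apply: sumr_ge0 => t _; exact: ltW.
  by apply: le_trans (bound N); rewrite big_geq.
by rewrite seriesEnat /= (big_cat_nat (leq0n N) (ltnW Nn))//= lerD2l bound.
Qed.

Lemma steps_bounded_below_cvg0 :
  (exists2 sstar : R, 0 < sstar & forall t, sstar <= s t) -> p @ \oo --> 0.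
Proof.
move=> [a a0 as_].
have ca0 : 0 < c * a by rewrite mulr_gt0.
have p2 : (fun t => p t ^+ 2) @ \oo --> 0.
  apply: cvg_series_cvg_0; apply: nondecreasing_is_cvgn.
    apply/nondecreasing_seqP => n.
    by rewrite !seriesEnat /= big_nat_recr//= lerDl sqr_ge0.
  exists (B / (c * a)) => _ [n _ <-].
  rewrite ler_pdivlMr// seriesEnat /= mulr_suml; apply: le_trans (sumB 0 n).
  apply: ler_sum_nat => t _; rewrite mulrC ler_wpM2r ?sqr_ge0//.
  by apply: le_trans (sigma_ge t); rewrite ler_pM2l.
have -> : p = Num.sqrt \o (fun t => p t ^+ 2).
  by apply/funext => t /=; rewrite sqrtr_sqr ger0_norm.
rewrite -[0 in X in _ --> X](@sqrtr0 R).
by apply: continuous_cvg p2; exact: sqrt_continuous.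
Qed.

End WeightedSquareSum.

(** * One step of the descent, integrated over the events of the past *)

Section OneStep.
Context {R : realType} {d : measure_display} {Omega : measurableType d}
  (P : probability Omega R) (G : set_system Omega).
Hypotheses (sG : sigma_algebra setT G) (GM : G `<=` measurable).
Local Open Scope ereal_scope.

(** The common term may have an infinite integral, so it is cancelled on the
events where it is at most [k]; these exhaust the space up to a null set. *)
Lemma integral_le_cancel (f1 f2 D : Omega -> \bar R) :
  measurable_fun setT f1 -> measurable_fun setT f2 -> measurable_wrt G D ->
  (forall w, 0 <= f1 w) -> (forall w, 0 <= f2 w) -> (forall w, 0 <= D w) ->
  {ae P, forall w, D w < +oo} ->
  (forall A, G A -> \int[P]_(w in A) f1 w + \int[P]_(w in A) D w <=
                    \int[P]_(w in A) f2 w + \int[P]_(w in A) D w) ->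
  forall A, G A -> \int[P]_(w in A) f1 w <= \int[P]_(w in A) f2 w.
Proof.
move=> mf1 mf2 mD f10 f20 D0 Dfin le_D A GA.
have mD' := measurable_wrtW sG GM mD.
have GD (B : set (\bar R)) : measurable B -> G (D @^-1` B).
  exact: (proj1 (measurable_wrtP _ sG) mD).
pose N := D @^-1` [set +oo].
have mN : measurable N by apply/GM/GD; exact: emeasurable_set1.
have N0 : P N = 0.
  apply/negligibleP => //; case: Dfin => M [mM M0 subM]; exists M; split => //.
  by move=> w Nw; apply: subM => /=; rewrite Nw ltxx.
rewrite (ge0_negligible_integral mN)//; [|exact: GM|exact: measurable_funTS].
pose Ak (k : nat) := A `&` (D @^-1` `]-oo, k%:R%:E]%classic).
have GAk k : G (Ak k).
  by apply: (sub_sigma_setI sG) => //; apply: GD; exact: emeasurable_itv.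
have -> : A `\` N = \bigcup_k Ak k.
  apply/seteqP; split=> w.
    move=> [Aw Nw]; have Dw : D w \is a fin_num.
      by rewrite ge0_fin_numE// ltey; apply/negP => /eqP.
    exists (Num.truncn (fine (D w))).+1 => //; split => //=.
    by rewrite in_itv /= -(fineK Dw) lee_fin ltW// truncnS_gt.
  move=> [k _ [Aw]] /=; rewrite in_itv /= => Dk; split => // Nw.
  by move: Dk; rewrite Nw.
have ndA : nondecreasing_seq Ak.
  move=> k l kl; apply/subsetPset => w [Aw] /=; rewrite !in_itv /= => Dk.
  by split => //=; rewrite in_itv /= (le_trans Dk)// lee_fin ler_nat.
have mAk k : measurable (Ak k) by exact: GM.
apply: (cvge_to_le (ge0_nondecreasing_set_cvg_integral ndA mAk _ _)) => //.
  by move=> k; exact: measurable_funTS.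
apply: nearW => k.
have Dk_fin : \int[P]_(w in Ak k) D w \is a fin_num.
  rewrite ge0_fin_numE ?integral_ge0//.
  apply: (@le_lt_trans _ _ (\int[P]_(w in Ak k) k%:R%:E)).
    apply: ge0_le_integral => //; first exact: (measurable_funTS mD').
    by move=> w [_] /=; rewrite in_itv.
  by rewrite integral_cst// lte_mul_pinfty// ltey_eq fin_num_measure.
have := le_D _ (GAk k); rewrite leeD2rE// => /le_trans; apply.
apply: ge0_subset_integral => //; first exact: GM.
  exact: measurable_funTS.
exact: subIsetl.
Qed.

(** The pointwise part of [one_step_descent], for the conditional expectations
[y], [m] and [z] of the positive and negative parts of [X] and of [Q]. The lower
bound on [y - m] makes [m] finite; [y] may still be infinite, and the excess is
then infinite as well. *)
Lemma excess_ge (s k b xi P2 Q2 cb c1 c2 : R) (y m z : \bar R) :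
  (0 < s)%R -> (0 <= k)%R -> 0 <= y -> 0 <= m -> 0 <= z ->
  y < +oo \/ m < +oo ->
  (cb * P2)%:E <= y - m -> z <= (c1 * P2 + c2 * Q2)%:E ->
  (k * c2 * Q2 + b <= xi)%R -> (0 <= (cb * s - k * c1) * P2)%R ->
  let D := s%:E * m + (k%:E * z + b%:E) in
  let N := s%:E * y + xi%:E in
  [/\ D < +oo, ((cb * s - k * c1) * P2)%:E <= maxe 0 (N - D) &
      maxe 0 (N - D) + D = N].
Proof.
move=> s0 k0 y0 m0 z0 ym_fin le_ym le_z le_xi gain0 /=.
have m_fin : m \is a fin_num.
  rewrite ge0_fin_numE// ltey; apply/eqP => mE.
  by move: le_ym ym_fin; rewrite mE; case: (y) => [r||] //= _ [].
have z_fin : z \is a fin_num.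
  by rewrite ge0_fin_numE// (le_lt_trans le_z)// ltry.
move: le_ym le_z; rewrite -(fineK m_fin) -(fineK z_fin).
move: (fine m) (fine z) => {m0 m_fin ym_fin z0 z_fin}m {}z.
case: y y0 => [y||] // _; last first.
  move=> _ _; rewrite gt0_muley ?lte_fin// -!EFinM -!EFinD !addye//.
  by rewrite (max_r (leey 0)) addye// ltry leey.
rewrite -!EFinM -!EFinD !lee_fin => le_ym le_z.
have h1 := ler_wpM2l (ltW s0) le_ym.
have h2 := ler_wpM2l k0 le_z.
have le_gain : ((cb * s - k * c1) * P2 <=
    s * y + xi - (s * m + (k * z + b)))%R by lra.
have excess0 := le_trans gain0 le_gain.
by rewrite -EFin_max max_r// -EFinD lee_fin subrK ltry; split.
Qed.

(** Here [V] and [V'] are the values of the objective before and after the step,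
[X] is the inner product of the gradient with its estimated projection, [Q] the
squared norm of the latter, and [p] and [q] are the norms of the projection of
the gradient and of its complement. The drift [W] is built from the conditional
expectations and not from their bounds in terms of [p]: in a nonseparable space,
the measurability of [p] is not clear. *)
Lemma one_step_descent (V V' s xi beta X Q p q : Omega -> R)
    (Y Z : Omega -> \bar R) (kappa cb c1 c2 : R) :
  (forall w, 0 <= V w)%R -> (forall w, 0 <= V' w)%R -> (forall w, 0 < s w)%R ->
  (forall w, 0 <= xi w)%R -> (forall w, 0 <= beta w)%R ->
  (forall w, 0 <= Q w)%R -> (0 <= kappa)%R ->
  measurable_fun setT V -> measurable_fun setT V' ->
  measurable_wrt G s -> measurable_wrt G xi -> measurable_wrt G beta ->
  (forall w, V' w <= V w - s w * X w + kappa * s w ^+ 2 * Q w + beta w)%R ->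
  is_condexp P G (EFin \o X) Y -> is_condexp P G (EFin \o Q) Z ->
  {ae P, forall w, (cb * p w ^+ 2)%:E <= Y w} ->
  {ae P, forall w, Z w <= (c1 * p w ^+ 2 + c2 * q w ^+ 2)%:E} ->
  {ae P, forall w, s w ^+ 2 * kappa * c2 * q w ^+ 2 + beta w <= xi w}%R ->
  {ae P, forall w, 0 <= cb * s w - s w ^+ 2 * kappa * c1}%R ->
  exists W : Omega -> \bar R,
    [/\ measurable_fun setT W, forall w, 0 <= W w,
      {ae P, forall w,
         ((cb * s w - s w ^+ 2 * kappa * c1) * p w ^+ 2)%:E <= W w} &
      forall A, G A ->
        \int[P]_(w in A) (V' w)%:E + \int[P]_(w in A) W w <=
        \int[P]_(w in A) (V w)%:E + \int[P]_(w in A) (xi w)%:E].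
Proof.
move=> V0 V'0 s0 xi0 beta0 Q0 kappa0 mV mV' ms mxi mbeta descent.
move=> [mX _ [Yp [Ym [ceYp ceYm Ypm]]]] [mQ _ [Zp [Zm [ceZp ceZm Zpm]]]].
move=> cbY Zc xi_ge sigma0.
have [[mYp Yp0 _] [mYm Ym0 _]] := (ceYp, ceYm).
have [[mZp Zp0 _] [mZm Zm0 intZm]] := (ceZp, ceZm).
have mGM d' (T' : measurableType d') (f : Omega -> T') :
  measurable_wrt G f -> measurable_fun setT f :=
  @measurable_wrtW _ _ _ sG GM _ _ f.
pose ks w := (kappa * s w ^+ 2)%R.
have mks : measurable_wrt G ks.
  apply: (@measurable_funM _ (g_sigma_algebraType G)) => //.
  exact: (@measurable_funX _ (g_sigma_algebraType G)).
have ks0 w : (0 <= ks w)%R by rewrite mulr_ge0// sqr_ge0.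
have Xp0 w : 0 <= (EFin \o X)^\+ w by exact: funepos_ge0.
have Xm0 w : 0 <= (EFin \o X)^\- w by exact: funeneg_ge0.
have mXp := measurable_funepos mX.
have mXm := measurable_funeneg mX.
have QE : (EFin \o Q)^\+ = EFin \o Q.
  apply/funext => w; apply: (@ge0_funeposE _ _ setT); rewrite ?in_setT// => v _.
  by rewrite lee_fin.
have QmE : (EFin \o Q)^\- = cst 0.
  apply/funext => w; apply: (@ge0_funenegE _ _ setT); rewrite ?in_setT// => v _.
  by rewrite lee_fin.
have Zm_ae0 : {ae P, forall w, Zm w = 0}.
  suff : ae_eq P setT Zm (cst 0) by apply: filterS => w; exact.
  apply/(ae_eq_integral_abs P measurableT (mGM _ _ _ mZm)).
  under eq_integral do rewrite gee0_abs//.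
  have GT : G setT by have := sub_sigma_setT sG.
  by rewrite (intZm _ GT) QmE integral0.
pose D w := (s w)%:E * Ym w + ((ks w)%:E * Zp w + (beta w)%:E).
pose N w := (s w)%:E * Yp w + (xi w)%:E.
have mEFin (f : Omega -> R) :
    measurable_wrt G f -> measurable_wrt G (EFin \o f).
  by move=> mf; apply: (@measurableT_comp _ _ _ (g_sigma_algebraType G)).
have mMul (f : Omega -> R) (h : Omega -> \bar R) : measurable_wrt G f ->
    measurable_wrt G h -> measurable_wrt G (fun w => (f w)%:E * h w).
  move=> mf mh; apply: (@emeasurable_funM _ (g_sigma_algebraType G)) => //.
  exact: mEFin.
have mD : measurable_wrt G D.
  apply: (@emeasurable_funD _ (g_sigma_algebraType G)); first exact: mMul.
  apply: (@emeasurable_funD _ (g_sigma_algebraType G)); first exact: mMul.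
  exact: mEFin.
have mN : measurable_wrt G N.
  apply: (@emeasurable_funD _ (g_sigma_algebraType G)); first exact: mMul.
  exact: mEFin.
have sE0 w : 0 <= (s w)%:E by rewrite lee_fin ltW.
have sYm0 w : 0 <= (s w)%:E * Ym w by rewrite mule_ge0.
have ksZp0 w : 0 <= (ks w)%:E * Zp w by rewrite mule_ge0// lee_fin.
have D0 w : 0 <= D w by rewrite !adde_ge0// lee_fin.
have N0 w : 0 <= N w by rewrite adde_ge0// ?mule_ge0// lee_fin.
pose W w := maxe 0 (N w - D w).
have key : {ae P, forall w, [/\ D w < +oo,
    ((cb * s w - s w ^+ 2 * kappa * c1) * p w ^+ 2)%:E <= W w &
    W w + D w = N w]}.
  near=> w.
  have [Y_ex YE] : (Yp w < +oo \/ Ym w < +oo) /\ Y w = Yp w - Ym w by near: w.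
  have [_ ZE] : (Zp w < +oo \/ Zm w < +oo) /\ Z w = Zp w - Zm w by near: w.
  have cY : (cb * p w ^+ 2)%:E <= Yp w - Ym w by rewrite -YE; near: w.
  have Zmw0 : Zm w = 0 by near: w.
  have cZ : Zp w <= (c1 * p w ^+ 2 + c2 * q w ^+ 2)%:E.
    by rewrite -[Zp w]sube0 -Zmw0 -ZE; near: w.
  have xiw : (s w ^+ 2 * kappa * c2 * q w ^+ 2 + beta w <= xi w)%R by near: w.
  have sgw : (0 <= cb * s w - s w ^+ 2 * kappa * c1)%R by near: w.
  have sigmaE : (cb * s w - s w ^+ 2 * kappa * c1 = cb * s w - ks w * c1)%R.
    by rewrite /ks [(s w ^+ 2 * _)%R]mulrC.
  rewrite sigmaE.
  apply: excess_ge (s0 w) (ks0 w) (Yp0 w) (Ym0 w) (Zp0 w) Y_ex cY cZ _ _.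
     by rewrite /ks [(kappa * _)%R]mulrC.
  by rewrite mulr_ge0 ?sqr_ge0// -sigmaE.
have mV0 : measurable_fun setT (EFin \o V) by exact/measurable_EFinP.
have mV'0 : measurable_fun setT (EFin \o V') by exact/measurable_EFinP.
have mW : measurable_fun setT W.
  apply: measurable_maxe; first exact: measurable_cst.
  by apply: emeasurable_funB; exact: mGM.
have W0 w : 0 <= W w by rewrite le_max lexx.
have msE (h : Omega -> \bar R) : measurable_fun setT h ->
    measurable_fun setT (fun w => (s w)%:E * h w).
  by move=> mh; apply: emeasurable_funM => //; exact/measurable_EFinP/mGM.
have mksQ : measurable_fun setT (fun w => (ks w)%:E * (EFin \o Q) w).
  by apply: emeasurable_funM => //; exact/measurable_EFinP/mGM.
have sXp0 w : 0 <= (s w)%:E * (EFin \o X)^\+ w by rewrite mule_ge0.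
have sXm0 w : 0 <= (s w)%:E * (EFin \o X)^\- w by rewrite mule_ge0.
have ksQ0 w : 0 <= (ks w)%:E * (EFin \o Q) w by rewrite mule_ge0// lee_fin.
have V0E w : 0 <= (V w)%:E by rewrite lee_fin.
have V'0E w : 0 <= (V' w)%:E by rewrite lee_fin.
have xi0E w : 0 <= (xi w)%:E by rewrite lee_fin.
have beta0E w : 0 <= (beta w)%:E by rewrite lee_fin.
have mxiE := mGM _ _ _ (mEFin _ mxi).
have mbetaE := mGM _ _ _ (mEFin _ mbeta).
have descentE w : (V' w)%:E + (s w)%:E * (EFin \o X)^\+ w <=
    (V w)%:E + ((s w)%:E * (EFin \o X)^\- w +
      ((ks w)%:E * (EFin \o Q) w + (beta w)%:E)).
  rewrite funeposE funenegE /= -!EFin_max -!EFinM -!EFinD lee_fin.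
  have : (Num.max (X w) 0 - Num.max (- X w) 0 = X w)%R.
    by case: (lerP (X w) 0); case: (lerP (- X w) 0); lra.
  have := descent w; rewrite /ks.
  move: (Num.max (X w) 0)%R (Num.max (- X w) 0)%R => a b + abE; rewrite -abE.
  lra.
have intD (B : set Omega) (a b : Omega -> \bar R) : measurable B ->
    measurable_fun setT a -> measurable_fun setT b ->
    (forall w, 0 <= a w) -> (forall w, 0 <= b w) ->
    \int[P]_(w in B) (a w + b w) = \int[P]_(w in B) a w + \int[P]_(w in B) b w.
  by move=> mB ma mb a0 b0; apply: ge0_integralD => //; exact: measurable_funTS.
exists W; split => //; first by apply: filterS key => w [].
move=> A GA; rewrite -!intD//; try exact: GM.
apply: (@integral_le_cancel _ _ D) => //; try exact: emeasurable_funD.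
- by move=> w; rewrite adde_ge0.
- by move=> w; rewrite adde_ge0.
- by apply: filterS key => w [].
move=> {GA}A GA.
have mA := GM GA.
rewrite (intD A (EFin \o V'))// (intD A (EFin \o V))//.
rewrite -addeA -(intD A W D)//; last exact: mGM.
have -> : \int[P]_(w in A) (W w + D w) = \int[P]_(w in A) N w.
  apply: ge0_ae_eq_integral => //.
  - by apply: measurable_funTS; apply: emeasurable_funD => //; exact: mGM.
  - by apply: measurable_funTS; exact: mGM.
  - by move=> w _; rewrite adde_ge0.
  - by apply: filterS key => w [].
have weight := @integral_condexp_weight _ _ _ P _ sG GM.
rewrite /N (intD A (fun w => (s w)%:E * Yp w))//; last 2 first.
- exact/msE/mGM.
- by move=> w; rewrite mule_ge0.
rewrite (weight _ _ s _ mXp Xp0 ceYp)//.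
rewrite addeA -(intD A (EFin \o V'))//; last exact: msE.
pose E w := (s w)%:E * (EFin \o X)^\- w +
  ((ks w)%:E * (EFin \o Q) w + (beta w)%:E).
have mksQb : measurable_fun setT
    (fun w => (ks w)%:E * (EFin \o Q) w + (beta w)%:E).
  exact: emeasurable_funD.
have mE : measurable_fun setT E by apply: emeasurable_funD => //; exact: msE.
have -> : \int[P]_(w in A) D w = \int[P]_(w in A) E w.
  rewrite (intD A (fun w => (s w)%:E * Ym w))//; last 3 first.
  - exact/msE/mGM.
  - by apply: emeasurable_funD => //; apply: mGM; exact: mMul.
  - by move=> w; rewrite adde_ge0.
  rewrite (intD A (fun w => (ks w)%:E * Zp w))//; last first.
    by apply: mGM; exact: mMul.
  rewrite (weight _ _ s _ mXm Xm0 ceYm)//.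
  rewrite (weight _ _ ks _ _ _ ceZp)// ?QE//.
  rewrite -intD// -intD//; first exact: msE.
  by move=> w; rewrite adde_ge0.
rewrite addeAC -(intD A (EFin \o V) E)//; last first.
  by move=> w; rewrite !adde_ge0.
apply: leeD2r; apply: ge0_le_integral => //.
- by move=> w _; apply: adde_ge0; [exact: V'0E|exact: sXp0].
- by apply: measurable_funTS; apply: emeasurable_funD => //; exact: msE.
- by apply: measurable_funTS; exact: emeasurable_funD.
- by move=> w _; exact: descentE.
Unshelve. all: end_near.
Qed.
End OneStep.

(** * The descent along the iterates *)

Lemma subspace_scale {R : realType} {H : completeNormedModType R}
    (T : set H) (dim : nat) (a : R) (v : H) :
  subspace_of_dim T dim -> T v -> T (a *: v).
Proof.
move=> [b [_ ->]] [c ->]; exists (fun i => a * c i).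
by rewrite scaler_sumr; apply: eq_bigr => i _; rewrite scalerA.
Qed.

Lemma retracted_step_descent {R : realType} {H : completeNormedModType R}
    (dot : {dot H for idfun}) (L : H -> R) (u g v : H) (r : H -> H)
    (Lip CR beta s : R) :
  let h := - (s *: v) in
  L (u + h) <= L u + dot g h + Lip / 2 * `|h| ^+ 2 ->
  L (r (u + h)) <= L (u + h) + CR / 2 * `|h| ^+ 2 + beta ->
  L (r (u - s *: v)) <=
    L u - s * dot g v + (Lip + CR) / 2 * s ^+ 2 * `|v| ^+ 2 + beta.
Proof.
move=> h; rewrite /h linearNr linearZr_LR /= normrN normrZ exprMn.
rewrite real_normK ?num_real//.
lra.
Qed.

(** The gain is concave in [s] and vanishes at [0] and at twice the step size
bound, so that at most half of its linear part is lost. *)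
Lemma step_gain_ge {R : realType} (K cb c1 s : R) :
  0 < K -> 0 < c1 -> 0 < s -> s <= 1 / K * (cb / c1) ->
  cb / 2 * s <= cb * s - s ^+ 2 * (K / 2) * c1.
Proof.
move=> K0 c10 s0 sle.
have : s * K * c1 <= cb.
  rewrite -ler_pdivlMr// -ler_pdivlMr//; apply: le_trans sle _.
  by rewrite mul1r mulrC.
move=> /(ler_wpM2l (ltW s0)); lra.
Qed.

Lemma partial_sums_le {R : realType} (a : nat -> R) (W : nat -> \bar R) :
  (forall t, (0 <= W t)%E) -> (forall t, ((a t)%:E <= W t)%E) ->
  (\sum_(0 <= t <oo) W t < +oo)%E ->
  forall m n, \sum_(m <= t < n) a t <= fine (\sum_(0 <= t <oo) W t)%E.
Proof.
move=> W0 aW Wfin m n; rewrite -lee_fin fineK; last first.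
  by rewrite ge0_fin_numE// nneseries_ge0.
rewrite -sumEFin; apply: (@le_trans _ _ (\sum_(m <= t < n) W t)%E).
  by apply: lee_sum => t _.
apply: (@le_trans _ _ (\sum_(0 <= t < n) W t)%E); last exact: nneseries_lim_ge.
have [mn|nm] := leqP m n; last by rewrite big_geq ?sume_ge0// ltnW.
by rewrite [leRHS](big_cat_nat (leq0n m) mn)//= leeDr// sume_ge0.
Qed.

Theorem theorem4p8 (R : realType)
  (dX : measure_display) (X : measurableType dX) (rho : probability X R)
  (H : completeNormedModType R) (dot : {dot H for idfun})
  (V : lmodType R) (ev : {linear H -> (X -> V)})
  (ell : H -> X -> R) (L : H -> R) (M : set H)
  (d : measure_display) (Omega : measurableType d) (P : probability Omega R)
  (F : nat -> set_system Omega)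
  (n : nat) (mu : nat -> Omega -> probability X R)
  (x : nat -> Omega -> n.-tuple X)
  (est : nat -> Omega -> n.-tuple X -> H -> H)
  (u g : nat -> Omega -> H) (T : nat -> Omega -> set H)
  (dim : nat -> Omega -> nat) (Pt Pn Rt : nat -> Omega -> H -> H)
  (s beta xi : nat -> Omega -> R)
  (Lip CR cbias1 cvar1 cvar2 : R)
  (hdot : hilbert_dot dot)
  (hev : injective ev)
  (hell : forall v, rho.-integrable setT (EFin \o ell v))
  (hL : forall v, L v = Rintegral rho setT (ell v))
  (hF : filtration F)
  (hu_meas : forall t, measurableH (F t) (u t))
  (hu0 : forall w, M (u 0%N w))
  (hg : forall t w, is_gradient dot L (u t w) (g t w))
  (hT : forall t w, subspace_of_dim (T t w) (dim t w))
  (hPt : forall t w, orthogonal_projection dot (T t w) (Pt t w))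
  (hT_meas : forall t h, measurableH (F t) (fun w => Pt t w h))
  (hx : forall t, cond_iid P (F t) (mu t) (x t))
  (hPn : built_from_samples F est x Pn)
  (hPnT : forall t w h, T t w (Pn t w h))
  (hs_meas : forall t, measurable_wrt (F t) (s t))
  (hs_gt0 : forall t w, 0 < s t w)
  (hRt : forall t w h, M (Rt t w h))
  (hRt_meas : forall t h, measurableH (F t) (fun w => Rt t w h))
  (hu : forall t w, u t.+1 w = Rt t w (u t w - s t w *: Pn t w (g t w)))
  (hLmin : ereal_inf [set (L v)%:E | v in M] \is a fin_num)
  (hLip : 0 < Lip) (hsmooth : restricted_smooth dot L u g T Lip)
  (hCR : 0 < CR) (hbeta_meas : forall t, measurable_wrt (F t) (beta t))
  (hbeta_ge0 : forall t w, 0 <= beta t w)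
  (hretr : controlled_retraction L u T Rt CR beta)
  (hcbias1 : 0 < cbias1) (hcvar1 : 0 < cvar1) (hcvar2 : 0 <= cvar2)
  (hbias : bounded_bias P dot F Pt Pn cbias1)
  (hvar : bounded_variance P F Pt Pn cvar1 cvar2)
  (hxi_meas : forall t, measurable_wrt (F t) (xi t))
  (hxi : {ae P, forall w, ell1 (xi ^~ w)})
  (hstep : {ae P, forall w, forall t,
     s t w ^+ 2 * ((Lip + CR) / 2) * cvar2 * `|g t w - Pt t w (g t w)| ^+ 2
       + beta t w <= xi t w
     /\ s t w <= 1 / (Lip + CR) * (cbias1 / cvar1)}) :
  let sigma t w := cbias1 * s t w - s t w ^+ 2 * ((Lip + CR) / 2) * cvar1 in
  let p t w := `|Pt t w (g t w)| in
  {ae P, forall w,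
    [/\ exists C : R, forall tau : nat, (1 <= tau)%N ->
          \big[Num.min/p 1%N w]_(1 <= t < tau.+1) p t w
            <= C * (\sum_(1 <= t < tau.+1) sigma t w) `^ (- 2^-1),
        ~ ell1 (s ^~ w) -> cluster ((p ^~ w) @ \oo) 0 &
        (exists2 sstar : R, 0 < sstar & forall t, sstar <= s t w) ->
          p ^~ w @ \oo --> 0]}.
Proof.
move=> sigma p.
have [sF FM Fle] := hF.
pose Lmin := fine (ereal_inf [set (L v)%:E | v in M]).
pose V0 t w := L (u t w) - Lmin.
have uM t w : M (u t w) by case: t => [//|t]; rewrite hu.
have V_ge0 t w : 0 <= V0 t w.
  rewrite subr_ge0 -lee_fin fineK//; apply: ereal_inf_lbound.
  by exists (u t w).
have mVF t : measurable_wrt (F t) (V0 t).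
  apply: (@measurable_funB _ (g_sigma_algebraType (F t))) => //.
  exact: (measurable_loss (sF t) (@hu_meas t) (hg t)).
have mV t : measurable_fun setT (V0 t) by apply: measurable_wrtW (mVF t).
(* Nonnegativity of [xi] is only almost sure, so its absolute value is used. *)
have mxi t : measurable_wrt (F t) (fun w => `|xi t w|).
  apply: (@measurableT_comp _ _ _ (g_sigma_algebraType (F t)) _ _ _ _ (xi t)).
    exact: normr_measurable.
  exact: hxi_meas.
have kappa0 : 0 <= (Lip + CR) / 2 by lra.
have sigma_ge : {ae P, forall w, forall t, cbias1 / 2 * s t w <= sigma t w}.
  apply: filterS hstep => w hw t; apply: step_gain_ge => //; first lra.
  by have [] := hw t.
have step t : exists W : Omega -> \bar R,
    [/\ measurable_fun setT W, forall w, (0 <= W w)%E,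
      {ae P, forall w, ((sigma t w * p t w ^+ 2)%:E <= W w)%E} &
      forall A, F t A ->
        (\int[P]_(w in A) (V0 t.+1 w)%:E + \int[P]_(w in A) W w <=
         \int[P]_(w in A) (V0 t w)%:E + \int[P]_(w in A) `|xi t w|%:E)%E].
  have mg := measurable_gradient (sF t) (@hu_meas t) (hg t) hdot.
  have [Y [ceY cbY]] := hbias t (g t) mg.
  have [Z [ceZ Zc]] := hvar t (g t) mg.
  apply: (one_step_descent (sF t) (FM t) (beta := beta t) (V_ge0 t) (V_ge0 t.+1)
    (hs_gt0 t) _ (hbeta_ge0 t) _ kappa0 (mV t) (mV t.+1) (@hs_meas t) (mxi t)
    (@hbeta_meas t) _ ceY ceZ cbY Zc) => //.
  - move=> w; rewrite /V0 hu.
    have Tv : T t w (- (s t w *: Pn t w (g t w))).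
      by rewrite -scaleNr; apply: subspace_scale (hT t w) (hPnT _ _ _).
    have := retracted_step_descent (L := L) (u := u t w) (r := Rt t w)
      (hsmooth t w _ Tv) (hretr t w _ Tv); lra.
  - apply: filterS hstep => w hw; have [+ _] := hw t.
    by move=> /le_trans; apply; exact: ler_norm.
  - apply: filterS sigma_ge => w /(_ t); apply: le_trans.
    by rewrite mulr_ge0 ?divr_ge0 ?ltW.
have {step} [W hW] := choice step.
have W_ge0 t w : (0 <= W t w)%E by have [] := hW t.
have mW t : measurable_fun setT (W t) by have [] := hW t.
have Wdescent t := let: And4 _ _ _ h := hW t in h.
have gainW : {ae P, forall w t, ((sigma t w * p t w ^+ 2)%:E <= W t w)%E}.
  by apply: ae_foralln => t; have [] := hW t.
have sumW := almost_supermartingale_sum hF V_ge0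
  (fun t w => normr_ge0 (xi t w)) W_ge0 (mVF 0%N) mV mxi mW Wdescent.
near=> w.
have sgw : forall t, cbias1 / 2 * s t w <= sigma t w by near: w.
have gw : forall t, ((sigma t w * p t w ^+ 2)%:E <= W t w)%E by near: w.
have xiw : ell1 (xi ^~ w) by near: w.
have Ww : (\sum_(0 <= t <oo) W t w < +oo)%E.
  have : cvgn (series (fun t => `|xi t w|)) ->
    (\sum_(0 <= t <oo) W t w < +oo)%E by near: w.
  exact.
have sumB := partial_sums_le (fun t => W_ge0 t w) gw Ww.
have cb2 : 0 < cbias1 / 2 by rewrite divr_gt0.
have s0 t := hs_gt0 t w.
have p0 t : 0 <= p t w by exact: normr_ge0.
split.
- exists (Num.sqrt (fine (\sum_(0 <= t <oo) W t w)%E)) => tau.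
  exact: (min_le_rate cb2 s0 sgw p0 sumB).
- exact: (not_summable_cluster0 cb2 s0 sgw p0 sumB).
- exact: (steps_bounded_below_cvg0 cb2 sgw p0 sumB).
Unshelve. all: end_near.
Qed.
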